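(* In the setting described in the context, assume that the system $\frac{\mathrm dy}{\mathrm dt}=Ay+G(y)+F$ on $\mathbb C^N$ admits an invariant probability measure $\mu$ that is physically relevant (in the sense of the context), and that the unresolved variable $\zeta\in E_{\mathfrak s}$ has finite energy: $$\int_{E_{\mathfrak c}\times E_{\mathfrak s}}\|\zeta\|^2\,\mathrm d\mu(\xi,\zeta)<\infty.$$ Then the minimization problem $$\min_{\Psi\in L^2_{\mathfrak m}(E_{\mathfrak c};E_{\mathfrak s})}\int_{(\xi,\zeta)\in E_{\mathfrak c}\times E_{\mathfrak s}}\|\zeta-\Psi(\xi)\|^2\,\mathrm d\mu(\xi,\zeta)$$ possesses a unique solution in $L^2_{\mathfrak m}(E_{\mathfrak c};E_{\mathfrak s})$, whose argmin is given by $$\Psi^\ast(\xi)=\int_{E_{\mathfrak s}}\zeta\,\mathrm d\mu_\xi(\zeta),\qquad \xi\in E_{\mathfrak c}.$$ Furthermore, for every $\Psi\in L^2_{\mathfrak m}(E_{\mathfrak c};E_{\mathfrak s})$, $$\lim_{T\to\infty}\mathcal Q_T(\Psi^\ast)\le\lim_{T\to\infty}\mathcal Q_T(\Psi),$$ where the limits are taken along a.e. solution $y(t)$ emanating from an initial datum $y_0$ in $B(\mu)$.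
   Context: Consider $\frac{\mathrm dy}{\mathrm dt}=X(y):=Ay+G(y)+F$, $y\in\mathbb C^N$, with $A$ an $N\times N$ complex matrix, $G$ a smooth nonlinearity and $F\in\mathbb C^N$ constant. The vector field $X$ is assumed sufficiently smooth and dissipative so that its flow $T_t$ on $\mathbb C^N$ is well defined. The eigenvalues $\beta_1,\dots,\beta_N$ of $A$ (with algebraic multiplicity), with generalized eigenvectors $\boldsymbol e_1,\dots,\boldsymbol e_N$ forming a basis of $\mathbb C^N$, are ordered so that real parts decrease with the index (ties: imaginary parts decrease). $m$ is such that $1\le m<N$ and $\mathrm{Re}(\beta_m)>\mathrm{Re}(\beta_{m+1})$. $E_{\mathfrak c}=\mathrm{span}\{\boldsymbol e_1,\dots,\boldsymbol e_m\}$ and $E_{\mathfrak s}=\mathrm{span}\{\boldsymbol e_{m+1},\dots,\boldsymbol e_N\}$, so $\mathbb C^N=E_{\mathfrak c}\oplus E_{\mathfrak s}$, identified with $E_{\mathfrak c}\times E_{\mathfrak s}$ via $y=\xi+\zeta\leftrightarrow(\xi,\zeta)$. $\Pi_{\mathfrak c},\Pi_{\mathfrak s}$ are the canonical projectors. For a solution $y(t)$, $y_{\mathfrak c}=\Pi_{\mathfrak c}y$ and $y_{\mathfrak s}=\Pi_{\mathfrak s}y$. Physically relevant measure: $\mu$ is a probability measure invariant under $T_t$, and there is a set $B(\mu)\subset\mathbb C^N$ of positive Lebesgue measure such that $$\lim_{T\to\infty}\frac1T\int_0^T\varphi(T_t(y))\,\mathrm dt=\int\varphi\,\mathrm d\mu$$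 for (a.e.) $y\in B(\mu)$. This is assumed not only for every continuous observable $\varphi$ but for every $\varphi\in L^1_\mu(\mathbb C^N)$ (the exceptional Lebesgue-null set may depend on $\varphi$). $\mathfrak m$ is the push-forward of $\mu$ by $\Pi_{\mathfrak c}$: $\mathfrak m(B)=\mu(\Pi_{\mathfrak c}^{-1}(B))$ for Borel $B\subset E_{\mathfrak c}$. $L^2_{\mathfrak m}(E_{\mathfrak c};E_{\mathfrak s})$ is the Hilbert space of measurable $\Psi:E_{\mathfrak c}\to E_{\mathfrak s}$ with $\int\|\Psi\|^2\,\mathrm d\mathfrak m<\infty$ (functions equal $\mathfrak m$-a.e. being identified). $\{\mu_\xi\}_{\xi\in E_{\mathfrak c}}$ is the disintegration of $\mu$ with respect to $\Pi_{\mathfrak c}$: the ($\mathfrak m$-a.e. uniquely determined) family of probability measures on $E_{\mathfrak s}$ with $\mu(B\times C)=\int_B\mu_\xi(C)\,\mathrm d\mathfrak m(\xi)$ for Borel $B\subset E_{\mathfrak c}$, $C\subset E_{\mathfrak s}$. For a solution $y(t)$, the parameterization defect is $\mathcal Q_T(\Psi)=\frac1T\int_0^T\|y_{\mathfrak s}(t)-\Psi(y_{\mathfrak c}(t))\|^2\,\mathrm dt$. *)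

(* Defs.v *)
From HB Require Import structures.
From mathcomp Require Import all_boot all_order all_algebra.
From mathcomp Require Import complex.
From mathcomp Require Import all_classical all_reals all_analysis.

Set Implicit Arguments.
Unset Strict Implicit.
Unset Printing Implicit Defensive.
Import Order.TTheory GRing.Theory Num.Theory.
Import numFieldNormedType.Exports.
Local Open Scope classical_set_scope.
Local Open Scope ring_scope.

(* C^N is 'cV[R[i]]_N; its real-analytic structure is that of R^{2N}, through
   y |-> (Re y_1, .., Re y_N, Im y_1, .., Im y_N). *)
Section Realification.
Context {R : realType} {N : nat}.

Definition realify (y : 'cV[R[i]]_N) : 'rV[R]_(N + N) :=
  row_mx (map_mx (@complex.Re R) y)^T (map_mx (@complex.Im R) y)^T.

Definition complexify (x : 'rV[R]_(N + N)) : 'cV[R[i]]_N :=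
  \col_i Complex (x 0 (lshift N i)) (x 0 (rshift N i)).

Definition rcoord (k : 'I_(N + N)) (y : 'cV[R[i]]_N) : R := realify y 0 k.

(* Hermitian norm (the library norm on matrices is the sup norm). *)
Definition hnorm (y : 'cV[R[i]]_N) : R :=
  Num.sqrt (\sum_(k < N + N) rcoord k y ^+ 2).

Lemma realifyK : cancel realify complexify.
Proof.
move=> y; apply/colP => i; rewrite mxE row_mxEl row_mxEr !mxE.
by case: (y i 0).
Qed.

Lemma complexifyK : cancel complexify realify.
Proof.
move=> x; apply/rowP => k; rewrite mxE.
by case: splitP => j jE; rewrite !mxE /=; congr (x _ _); apply: val_inj.
Qed.

End Realification.

(* Borel sigma-algebras of C^N and of its complex subspaces, generated by the
   2N real coordinate functions. *)
Definition cV_display : measure_display. Proof. exact. Qed.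
Definition subvs_display : measure_display. Proof. exact. Qed.

Section Borel.
Context (R : realType) (N : nat).

HB.instance Definition _ := isPointed.Build R[i] 0.

Definition cV_measurable : set (set 'cV[R[i]]_N) :=
  g_sigma_preimage (@rcoord R N).

Let cV_set0 : cV_measurable set0.
Proof. exact: sigma_algebra0. Qed.

Let cV_setC A : cV_measurable A -> cV_measurable (~` A).
Proof. exact: sigma_algebraC. Qed.

Let cV_bigcup (F : _^nat) : (forall i, cV_measurable (F i)) ->
  cV_measurable (\bigcup_i (F i)).
Proof. exact: sigma_algebra_bigcup. Qed.

HB.instance Definition _ := @isMeasurable.Build cV_display
  'cV[R[i]]_N cV_measurable cV_set0 cV_setC cV_bigcup.

Variable U : {vspace 'cV[R[i]]_N}.

HB.instance Definition _ := isPointed.Build (subvs_of U) 0.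

Definition subvs_measurable : set (set (subvs_of U)) :=
  g_sigma_preimage (fun k (u : subvs_of U) => rcoord k (vsval u)).

Let subvs_set0 : subvs_measurable set0.
Proof. exact: sigma_algebra0. Qed.

Let subvs_setC A : subvs_measurable A -> subvs_measurable (~` A).
Proof. exact: sigma_algebraC. Qed.

Let subvs_bigcup (F : _^nat) : (forall i, subvs_measurable (F i)) ->
  subvs_measurable (\bigcup_i (F i)).
Proof. exact: sigma_algebra_bigcup. Qed.

HB.instance Definition _ := @isMeasurable.Build subvs_display
  (subvs_of U) subvs_measurable subvs_set0 subvs_setC subvs_bigcup.

End Borel.


Section Lebesgue.
Context {R : realType}.
Local Notation mR := (measurableTypeR R).

Let pushforward_additive d1 d2 (T1 : measurableType d1) (T2 : measurableType d2)
    (m : {measure set T1 -> \bar R}) (f : T1 -> T2) :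
  measurable_fun setT f -> semi_sigma_additive (pushforward m f).
Proof.
move=> mf; have mpre A : measurable A -> measurable (f @^-1` A).
  by move=> mA; rewrite -[X in measurable X]setTI; exact: mf.
move=> F mF tF mUF; rewrite /pushforward preimage_bigcup.
apply: measure_semi_sigma_additive.
- by move=> k; exact: mpre.
- apply/trivIsetP => /= i j _ _ ij; rewrite -preimage_setI.
  by move/trivIsetP : tF => /(_ _ _ _ _ ij) ->//; rewrite preimage_set0.
- by rewrite -preimage_bigcup; exact: mpre.
Qed.

Definition tuple_cons n (p : mR * n.-tuple mR) : n.+1.-tuple mR :=
  [tuple of p.1 :: p.2].

Let tuple_uncons n (t : n.+1.-tuple mR) : mR * n.-tuple mR :=
  (thead t, [tuple of behead t]).

Let measurable_tuple_cons n : measurable_fun setT (@tuple_cons n).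
Proof. exact: measurable_cons. Qed.

Let measurable_tuple_uncons n : measurable_fun setT (@tuple_uncons n).
Proof.
by apply/measurable_fun_pair; [exact: measurable_tnth|exact: measurable_behead].
Qed.

Let tuple_consK n : cancel (@tuple_cons n) (@tuple_uncons n).
Proof. by move=> [a t]; congr pair; apply: val_inj. Qed.

Section Cons.
Context n (mu : {sigma_finite_measure set (n.-tuple mR) -> \bar R}).

Definition lebesgue_cons : set (n.+1.-tuple mR) -> \bar R :=
  pushforward (lebesgue_measure \x mu)%E (@tuple_cons n).

Let lebesgue_cons0 : lebesgue_cons set0 = 0%E.
Proof. by rewrite /lebesgue_cons /pushforward preimage_set0 measure0. Qed.

Let lebesgue_cons_ge0 A : (0 <= lebesgue_cons A)%E.
Proof. exact: (measure_ge0 (lebesgue_measure \x mu)%E). Qed.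

Let lebesgue_cons_sigma_additive : semi_sigma_additive lebesgue_cons.
Proof. exact: pushforward_additive (@measurable_tuple_cons n). Qed.

HB.instance Definition _ := isMeasure.Build _ _ _ lebesgue_cons
  lebesgue_cons0 lebesgue_cons_ge0 lebesgue_cons_sigma_additive.

Let lebesgue_cons_sigma_finite : sigma_finite setT lebesgue_cons.
Proof.
have /sigma_finiteP[F [FT ndF Foo]] := sigma_finiteT (@lebesgue_measure R).
have /sigma_finiteP[G [GT ndG Goo]] := sigma_finiteT mu.
exists (fun k => @tuple_uncons n @^-1` (F k `*` G k)).
  rewrite -preimage_bigcup (_ : \bigcup_i _ = setT) ?preimage_setT//.
  apply/seteqP; split => // -[x y] _.
  have : [set: mR] x by []; rewrite FT => -[p _ Fx].
  have : [set: n.-tuple mR] y by []; rewrite GT => -[q _ Gy].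
  exists (maxn p q) => //; split => /=.
  - by move: x Fx; exact/subsetPset/ndF/leq_maxl.
  - by move: y Gy; exact/subsetPset/ndG/leq_maxr.
move=> k; have [mF Fk] := Foo k; have [mG Gk] := Goo k; split.
  rewrite -[X in measurable X]setTI; apply: measurable_tuple_uncons => //.
  exact: measurableX.
rewrite /lebesgue_cons /pushforward -comp_preimage.
rewrite (_ : _ \o _ = id); last by apply/funext => x; rewrite /= tuple_consK.
by rewrite preimage_id product_measure1E// lte_mul_pinfty// ge0_fin_numE.
Qed.

HB.instance Definition _ := Measure_isSigmaFinite.Build _ _ _ lebesgue_cons
  lebesgue_cons_sigma_finite.

End Cons.

Fixpoint lebesgue_tuple n : {sigma_finite_measure set (n.-tuple mR) -> \bar R} :=
  match n with
  | 0 => \d_([tuple] : 0.-tuple mR)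
  | n'.+1 => lebesgue_cons (lebesgue_tuple n')
  end.

Definition tuple_complexify N (t : (N + N).-tuple mR) : 'cV[R[i]]_N :=
  complexify (\row_k tnth t k).

Let measurable_tuple_complexify N : measurable_fun setT (@tuple_complexify N).
Proof.
move=> _; suff H : @cV_measurable R N `<=`
    [set A | measurable (@tuple_complexify N @^-1` A)].
  by move=> A /H; rewrite setTI.
apply: smallest_sub.
  split => [|A|F] /=.
  - by rewrite preimage_set0.
  - by rewrite setTD preimage_setC => /measurableC.
  - by move=> mF; rewrite preimage_bigcup; exact: bigcup_measurable.
move=> A; rewrite -bigcup_seq => -[k _ [B mB <-]] /=.
rewrite setTI -comp_preimage (_ : _ \o _ = (@tnth _ mR)^~ k).
  by rewrite -[X in measurable X]setTI; exact: measurable_tnth.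
by apply/funext => t /=; rewrite /rcoord /tuple_complexify complexifyK mxE.
Qed.

(* Lebesgue measure of R^{2N} transported to C^N. *)
Definition lebesgue_cV N : set 'cV[R[i]]_N -> \bar R :=
  pushforward (lebesgue_tuple (N + N)) (@tuple_complexify N).

Section Instance.
Context (N : nat).

Let lebesgue_cV0 : @lebesgue_cV N set0 = 0%E.
Proof. by rewrite /lebesgue_cV /pushforward preimage_set0 measure0. Qed.

Let lebesgue_cV_ge0 A : (0 <= @lebesgue_cV N A)%E.
Proof. exact: (measure_ge0 (lebesgue_tuple (N + N))). Qed.

Let lebesgue_cV_sigma_additive : semi_sigma_additive (@lebesgue_cV N).
Proof. exact: pushforward_additive (@measurable_tuple_complexify N). Qed.

HB.instance Definition _ := isMeasure.Build _ _ _ (@lebesgue_cV N)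
  lebesgue_cV0 lebesgue_cV_ge0 lebesgue_cV_sigma_additive.

End Instance.
End Lebesgue.

Section Dynamics.
Context {R : realType} {N : nat}.
Local Notation Cn := 'cV[R[i]]_N.

Definition generalized_eigenbasis (A : 'M[R[i]]_N) (beta : N.-tuple R[i])
    (e : N.-tuple Cn) : Prop :=
  [/\ char_poly A = \prod_(b <- beta) ('X - b%:P),
      basis_of fullv e &
      forall i : 'I_N, exists k : nat,
        (A - (tnth beta i)%:M) ^+ k *m tnth e i = 0].

Definition spectrally_ordered (beta : N.-tuple R[i]) : Prop :=
  forall i j : 'I_N, (i <= j)%N ->
    complex.Re (tnth beta j) < complex.Re (tnth beta i) \/
    complex.Re (tnth beta j) = complex.Re (tnth beta i) /\
    complex.Im (tnth beta j) <= complex.Im (tnth beta i).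

(* Re(beta_m) > Re(beta_{m+1}) with the 1-based numbering of the eigenvalues,
   i.e. the 0-based positions m - 1 and m. *)
Definition spectral_gap (beta : N.-tuple R[i]) (m : nat) : Prop :=
  forall i j : 'I_N, i.+1 = m -> j = m :> nat ->
    complex.Re (tnth beta j) < complex.Re (tnth beta i).

Definition resolved_space (e : N.-tuple Cn) (m : nat) : {vspace Cn} :=
  <<take m e>>%VS.

Definition unresolved_space (e : N.-tuple Cn) (m : nat) : {vspace Cn} :=
  <<drop m e>>%VS.

(* C^1 in the real sense. *)
Definition real_C1 (X : Cn -> Cn) : Prop :=
  let Xr := realify \o X \o complexify in
  (forall x, differentiable Xr x) /\ (forall v, continuous (fun x => 'd Xr x v)).

Definition is_solution (X : Cn -> Cn) (y : R -> Cn) : Prop :=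
  {within `[0, +oo[, continuous (realify \o y)} /\
  forall t : R, 0 < t -> is_derive t 1 (realify \o y) (realify (X (y t))).

(* For a C^1 vector field the forward solution from each point is unique, so
   this determines S t for t >= 0; the values S t for t < 0 are irrelevant. *)
Definition is_flow (X : Cn -> Cn) (S : R -> Cn -> Cn) : Prop :=
  forall y0 : Cn, S 0 y0 = y0 /\ is_solution X (S ^~ y0).

Definition invariant_measure (S : R -> Cn -> Cn) (mu : probability Cn R) : Prop :=
  forall t : R, 0 <= t -> forall D : set Cn, measurable D ->
    mu (S t @^-1` D) = mu D.

(* B is Lebesgue measurable (a Borel set up to a null set), of positive
   measure. *)
Definition positive_lebesgue (B : set Cn) : Prop :=
  exists B1 B2 : set Cn,
    [/\ measurable B1, measurable B2, B1 `<=` B /\ B `<=` B2,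
        lebesgue_cV (B2 `\` B1) = 0%E & (0 < lebesgue_cV B1)%E].

Definition time_average (f : R -> R) (T : R) : \bar R :=
  ((T^-1)%:E * \int[lebesgue_measure]_(t in `[0%R, T]) (f t)%:E)%E.

Definition physically_relevant (S : R -> Cn -> Cn) (mu : probability Cn R)
    (B : set Cn) : Prop :=
  [/\ invariant_measure S mu, positive_lebesgue B &
      forall phi : Cn -> R, mu.-integrable setT (EFin \o phi) ->
        \forall y \ae @lebesgue_cV R N, B y ->
          time_average (fun t => phi (S t y)) T @[T --> +oo%R] -->
          (\int[mu]_z (phi z)%:E)%E].

End Dynamics.

(* Integral of a function with values in a finite-dimensional complex space,
   through coordinates; it does not depend on the basis when f is integrable. *)
Definition vect_integral {R : realType} d (T : measurableType d)
    (nu : {measure set T -> \bar R}) (V : vectType R[i]) (f : T -> V) : V :=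
  \sum_(j < \dim {:V})
    Complex (\int[nu]_x complex.Re (coord (vbasis {:V}) j (f x)))
            (\int[nu]_x complex.Im (coord (vbasis {:V}) j (f x)))
    *: (vbasis {:V})`_j.

Section Closure.
Context {R : realType} {N : nat} (Ec Es : {vspace 'cV[R[i]]_N}).
Local Notation Cn := 'cV[R[i]]_N.

(* Projection onto U along W; meaningful when C^N is the direct sum. *)
Definition proj_along (U W : {vspace Cn}) (y : Cn) : subvs_of U :=
  vsproj U (daddv_pi U W y).

Definition Pi_c : Cn -> subvs_of Ec := proj_along Ec Es.
Definition Pi_s : Cn -> subvs_of Es := proj_along Es Ec.

Definition sqnorm (zeta : subvs_of Es) : R := hnorm (vsval zeta) ^+ 2.

Context (mu : probability Cn R).

Definition resolved_law : set (subvs_of Ec) -> \bar R := pushforward mu Pi_c.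

Definition is_disintegration (mu_ : R.-pker (subvs_of Ec) ~> (subvs_of Es)) : Prop :=
  forall (D : set (subvs_of Ec)) (E : set (subvs_of Es)),
    measurable D -> measurable E ->
    mu [set y | D (Pi_c y) /\ E (Pi_s y)] =
    (\int[resolved_law]_(xi in D) mu_ xi E)%E.

Definition finite_energy : Prop := (\int[mu]_y (sqnorm (Pi_s y))%:E < +oo)%E.

(* Representatives of the elements of L^2_m(Ec; Es); functions that agree
   m-almost everywhere represent the same element. *)
Definition L2m (Psi : subvs_of Ec -> subvs_of Es) : Prop :=
  measurable_fun setT Psi /\
  (\int[resolved_law]_xi (sqnorm (Psi xi))%:E < +oo)%E.

Definition mean_square_defect (Psi : subvs_of Ec -> subvs_of Es) : \bar R :=
  (\int[mu]_y (sqnorm (Pi_s y - Psi (Pi_c y)))%:E)%E.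

Definition is_minimizer (Psi : subvs_of Ec -> subvs_of Es) : Prop :=
  L2m Psi /\
  forall Phi, L2m Phi -> (mean_square_defect Psi <= mean_square_defect Phi)%E.

Definition conditional_mean (mu_ : R.-pker (subvs_of Ec) ~> (subvs_of Es))
    (xi : subvs_of Ec) : subvs_of Es :=
  vect_integral (mu_ xi) (fun zeta => zeta).

(* Q_T(Psi) along the curve y. *)
Definition param_defect (y : R -> Cn) (Psi : subvs_of Ec -> subvs_of Es)
    (T : R) : \bar R :=
  time_average (fun t => sqnorm (Pi_s (y t) - Psi (Pi_c (y t)))) T.

End Closure.

Arguments resolved_law {R N} Ec Es mu _ : rename.

(* Main.v *)
Require Import Defs.
From HB Require Import structures.
From mathcomp Require Import all_boot all_order all_algebra.
From mathcomp Require Import complex.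
From mathcomp Require Import ring lra.
From mathcomp Require Import all_classical all_reals all_analysis.
From mathcomp Require Import measurable_realfun.

Set Implicit Arguments.
Unset Strict Implicit.
Unset Printing Implicit Defensive.
Import Order.TTheory GRing.Theory Num.Theory.
Import numFieldNormedType.Exports.
Local Open Scope classical_set_scope.
Local Open Scope ring_scope.

(** Write [Ez(xi)] for the mean of the fibre measure [mu_ xi].  On a fibre, the
    scalar identity E|z - a|^2 = E|z - Ez|^2 + |Ez - a|^2 holds for every
    candidate value [a]; integrating it over the resolved law, with
    [a = Psi xi], gives the Pythagorean identity

      defect Psi = defect (conditional mean) + ||conditional mean - Psi||^2

    in L^2 of the resolved law (lemma [pythagoras]).  Existence, the formula for
    the minimizer and uniqueness up to a null set are all read off from it:
    the last term is nonnegative, and it vanishes only when [Psi] is almost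
    everywhere the conditional mean.  Taking [Psi = 0] turns the finite energy
    into square integrability of the conditional mean.

    The dynamical part follows because for [Psi] in L^2 the function
    |Pi_s y - Psi (Pi_c y)|^2 is mu-integrable ([L2m_defect_integrable]); its
    time averages along almost every trajectory from [B] therefore tend to its
    space average, which is the defect of [Psi], and defects are compared by the
    Pythagorean identity.

    Two tools carry the passage to fibres.  First, a disintegration, given on
    rectangles only, determines the integral of every nonnegative measurable
    function ([integral_disintegration]).  Second, the fibre mean is a complex
    vector given by its coordinates in a basis, whereas norms and Borel sets are
    described by the 2N real coordinates of the ambient space; real-linear
    functionals connect the two descriptions, being combinations of the real
    coordinates ([real_linear_rcoordE]) that commute with the integral
    ([real_linear_vect_integral]). *)

(** * Integration against a disintegrated measure *)

Section disintegrated_integral.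
Local Open Scope ereal_scope.
Context d1 d2 (X : measurableType d1) (Y : measurableType d2) (R : realType).
Variables (m : probability X R) (k : R.-pker X ~> Y).

(** The measure [k x] moved to the slice over [x].  The unit component is there
    only because composition of kernels is parametrized: [m] enters it as a
    constant kernel on a one-point space. *)
Definition fiber_law (p : unit * X) : set (X * Y) -> \bar R :=
  pushforward (k p.2) (pair p.2).

Let fiber_law0 p : fiber_law p set0 = 0.
Proof. exact: measure0. Qed.

Let fiber_law_ge0 p A : 0 <= fiber_law p A.
Proof. exact: measure_ge0. Qed.

Let fiber_law_sigma_additive p : semi_sigma_additive (fiber_law p).
Proof. exact: measure_semi_sigma_additive. Qed.

HB.instance Definition _ p := isMeasure.Build _ _ _ (fiber_law p)
  (fiber_law0 p) (fiber_law_ge0 p) (@fiber_law_sigma_additive p).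

Definition fiber_kernel (p : unit * X) : {measure set (X * Y) -> \bar R} :=
  fiber_law p.

Let measurable_fiber_kernel A : measurable A ->
  measurable_fun [set: unit * X] (fun p => fiber_kernel p A : \bar R).
Proof.
move=> mA.
rewrite (_ : (fun p => _) = (fun x => k x (xsection A x)) \o snd); last first.
  apply/funext => -[[] x] /=; congr (k x _).
  by apply/seteqP; split => y; rewrite /xsection /= inE.
apply: measurableT_comp; last exact: measurable_snd.
by apply: measurable_fun_xsection_finite_kernel; rewrite inE.
Qed.

HB.instance Definition _ := isKernel.Build _ _ _ _ _ fiber_kernel
  measurable_fiber_kernel.

Let fiber_kernel_prob p : fiber_kernel p [set: X * Y] = 1.
Proof.
by rewrite /fiber_kernel /= /fiber_law /pushforward preimage_setT prob_kernel.
Qed.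

HB.instance Definition _ := Kernel_isProbability.Build _ _ _ _ _ fiber_kernel
  fiber_kernel_prob.

Let base_kernel : R.-pker unit ~> X :=
  kprobability (measurable_cst (m : pprobability X R)).

(** Rectangles are stable under intersection and generate the product
    sigma-algebra, so two finite measures that agree on them are equal. *)
Lemma disintegrated_measureE (P : {measure set (X * Y) -> \bar R}) :
  (forall D E, measurable D -> measurable E ->
    P (D `*` E) = \int[m]_(x in D) k x E) ->
  forall A, measurable A -> P A = kcomp base_kernel fiber_kernel tt A.
Proof.
move=> PE A mA.
have rectE D E : measurable D -> measurable E ->
    kcomp base_kernel fiber_kernel tt (D `*` E) = \int[m]_(x in D) k x E.
  move=> mD mE; rewrite /kcomp [RHS]integral_mkcond.
  apply: eq_integral => x _.
  rewrite /fiber_kernel /= /fiber_law /pushforward /patch.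
  case: ifPn => [|/negP] /[!inE] Dx.
    by congr (k x _); apply/seteqP; split => y //= [].
  by rewrite -[RHS](measure0 (k x)); congr (k x _); apply/seteqP; split => y //= [].
apply: (@measure_unique _ _ _
  [set D `*` E | D in measurable & E in measurable] (fun=> setT)) => //.
- exact: measurable_prod_measurableType.
- move=> _ _ [D1 mD1 [E1 mE1 <-]] [D2 mD2 [E2 mE2 <-]].
  exists (D1 `&` D2); first exact: measurableI.
  by exists (E1 `&` E2); [exact: measurableI|rewrite setXI].
- by move=> _; exists setT => //; exists setT => //; rewrite setXTT.
- by rewrite bigcup_const//; exists 0%N.
- by move=> _ [D mD [E mE <-]]; rewrite PE// -rectE.
- move=> _; rewrite -setXTT PE// (eq_integral (cst 1)); last first.
    by move=> x _; rewrite prob_kernel.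
  by rewrite integral_cst// mul1e -ge0_fin_numE// fin_num_measure.
Qed.

(** Tonelli for a product that varies with the base point. *)
Lemma integral_disintegration (P : {measure set (X * Y) -> \bar R})
    (f : X * Y -> \bar R) :
  (forall D E, measurable D -> measurable E ->
    P (D `*` E) = \int[m]_(x in D) k x E) ->
  (forall z, 0 <= f z) -> measurable_fun [set: X * Y] f ->
  \int[P]_z f z = \int[m]_x \int[k x]_y f (x, y).
Proof.
move=> PE f0 mf.
rewrite (eq_measure_integral (mkcomp base_kernel fiber_kernel tt)); last first.
  by move=> A mA _; exact: disintegrated_measureE.
rewrite integral_kcomp//; apply: eq_integral => x _.
by rewrite ge0_integral_pushforward// preimage_setT.
Qed.

End disintegrated_integral.

(** * Real-linear functionals on complex spaces *)

Section real_linear.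
Context (R : realType).

(** Linearity over the subfield of real scalars: real and imaginary parts and
    the real coordinates have it, without being complex-linear. *)
Definition real_linear (V : lmodType R[i]) (f : V -> R) : Prop :=
  forall (r : R) (u v : V), f (r%:C%C *: u + v) = r * f u + f v.

Section theory.
Variables (V : lmodType R[i]) (f : V -> R).
Hypothesis lf : real_linear f.

Lemma real_linear0 : f 0 = 0.
Proof.
have := lf 1 0 0; rewrite scale1r addr0 mul1r => /eqP.
by rewrite -subr_eq0 opprD addNKr oppr_eq0 => /eqP.
Qed.

Lemma real_linearZ r u : f (r%:C%C *: u) = r * f u.
Proof. by rewrite -[X in f X]addr0 lf real_linear0 addr0. Qed.

Lemma real_linearD u v : f (u + v) = f u + f v.
Proof. by have := lf 1 u v; rewrite scale1r mul1r. Qed.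

Lemma real_linearB u v : f (u - v) = f u - f v.
Proof.
have := lf (-1) v u; rewrite rmorphN rmorph1 scaleN1r mulN1r.
by rewrite ![- _ + _]addrC.
Qed.

Lemma real_linear_sum (I : Type) (s : seq I) (F : I -> V) :
  f (\sum_(i <- s) F i) = \sum_(i <- s) f (F i).
Proof. exact: (big_morph f real_linearD real_linear0). Qed.

Lemma real_linear_complexZ (z : R[i]) u :
  f (z *: u) = complex.Re z * f u + complex.Im z * f ('i%C *: u).
Proof.
rewrite -!real_linearZ scalerA -real_linearD -scalerDl mulrC.
by rewrite -complexE.
Qed.

End theory.

Lemma real_linear_comp (V W : lmodType R[i]) (g : {linear V -> W}) (f : W -> R) :
  real_linear f -> real_linear (f \o g).
Proof. by move=> lf r u v /=; rewrite linearP lf. Qed.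

Lemma real_linear_lin (I : Type) (s : seq I) (V : lmodType R[i])
    (F : I -> V -> R) (a : I -> R) :
  (forall i, real_linear (F i)) ->
  real_linear (fun v => \sum_(i <- s) a i * F i v).
Proof.
move=> lF r u v; rewrite mulr_sumr -big_split /=; apply: eq_bigr => i _.
by rewrite lF; ring.
Qed.

Lemma real_linear_Re : @real_linear R[i]^o (@complex.Re R).
Proof. by move=> r [a b] [c d]; rewrite /= mul0r subr0. Qed.

Lemma real_linear_Im : @real_linear R[i]^o (@complex.Im R).
Proof. by move=> r [a b] [c d]; rewrite /= mul0r addr0. Qed.

End real_linear.

(** * Real coordinates, norm and Borel structure *)

Section coordinates.
Context (R : realType) (N : nat).
Local Notation Cn := 'cV[R[i]]_N.

Lemma real_linear_rcoord k : real_linear (@rcoord R N k).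
Proof.
move=> r u v; rewrite /rcoord /realify -(splitK k).
by case: (fintype.split k) => j /=; rewrite ?row_mxEl ?row_mxEr !mxE;
  [exact: real_linear_Re|exact: real_linear_Im].
Qed.

Lemma rcoord_inj (u v : Cn) : (forall k, rcoord k u = rcoord k v) -> u = v.
Proof. by move=> uv; apply: (can_inj realifyK); apply/rowP => k; exact: uv. Qed.

Lemma real_linear_rcoordE (f : Cn -> R) y : real_linear f ->
  f y = \sum_(k < N + N) f (complexify (delta_mx 0 k)) * rcoord k y.
Proof.
move=> lf.
rewrite [in LHS](_ : y = \sum_(k < N + N)
    (rcoord k y)%:C%C *: complexify (delta_mx 0 k)).
  rewrite (real_linear_sum lf); apply: eq_bigr => k _.
  by rewrite (real_linearZ lf) mulrC.
apply: rcoord_inj => j; rewrite (real_linear_sum (real_linear_rcoord j)).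
have deltaE k : rcoord j (complexify (delta_mx 0 k)) = (j == k)%:R.
  by rewrite /rcoord complexifyK mxE eqxx.
rewrite (bigD1 j)//= (real_linearZ (real_linear_rcoord j)) deltaE eqxx mulr1.
rewrite big1 ?addr0// => k kj.
by rewrite (real_linearZ (real_linear_rcoord j)) deltaE eq_sym (negbTE kj) mulr0.
Qed.

Lemma hnormX2 (y : Cn) : hnorm y ^+ 2 = \sum_(k < N + N) rcoord k y ^+ 2.
Proof. by rewrite /hnorm sqr_sqrtr// sumr_ge0// => k _; exact: sqr_ge0. Qed.

Lemma hnorm_ge0 (y : Cn) : 0 <= hnorm y.
Proof. exact: sqrtr_ge0. Qed.

Lemma le_rcoord_hnorm k (y : Cn) : `|rcoord k y| <= hnorm y.
Proof.
rewrite -ler_sqr ?nnegrE ?normr_ge0 ?hnorm_ge0// real_normK ?num_real// hnormX2.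
by rewrite (bigD1 k)//= lerDl sumr_ge0// => j _; exact: sqr_ge0.
Qed.

Lemma hnorm_eq0 (y : Cn) : hnorm y = 0 -> y = 0.
Proof.
move=> y0; apply: rcoord_inj => k; rewrite (real_linear0 (real_linear_rcoord k)).
by apply/eqP; rewrite -normr_le0 -y0 le_rcoord_hnorm.
Qed.

Lemma measurable_rcoord k : measurable_fun [set: Cn] (@rcoord R N k).
Proof.
move=> _ A mA; apply: sub_sigma_algebra; rewrite -bigcup_seq.
by exists k; [rewrite /= mem_index_enum|exists A].
Qed.

Lemma measurable_real_linear (f : Cn -> R) :
  real_linear f -> measurable_fun [set: Cn] f.
Proof.
move=> lf.
rewrite (_ : f = fun y => \sum_(k < N + N) f (complexify (delta_mx 0 k)) * rcoord k y).
  apply: measurable_sum => k; apply: measurable_funM => //.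
  exact: measurable_rcoord.
by apply/funext => y; exact: real_linear_rcoordE.
Qed.

Section subspace.
Variable U : {vspace Cn}.

Lemma real_linear_rcoord_subvs k :
  real_linear (fun u : subvs_of U => rcoord k (vsval u)).
Proof. exact: (real_linear_comp (@vsval _ _ U) (real_linear_rcoord k)). Qed.

Lemma measurable_rcoord_subvs k :
  measurable_fun [set: subvs_of U] (fun u => rcoord k (vsval u)).
Proof.
move=> _ A mA; apply: sub_sigma_algebra; rewrite -bigcup_seq.
by exists k; [rewrite /= mem_index_enum|exists A].
Qed.

(** A functional on a subspace extends to the ambient space through the
    projection [vsproj], so the ambient coordinates suffice to express it. *)
Lemma real_linear_subvsE (f : subvs_of U -> R) u : real_linear f ->
  f u = \sum_(k < N + N)
    f (vsproj U (complexify (delta_mx 0 k))) * rcoord k (vsval u).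
Proof.
move=> lf; rewrite -[u in LHS]vsvalK.
exact: (real_linear_rcoordE _ (real_linear_comp (vsproj U) lf)).
Qed.

Lemma measurable_real_linear_subvs (f : subvs_of U -> R) :
  real_linear f -> measurable_fun [set: subvs_of U] f.
Proof.
move=> lf.
rewrite (_ : f = fun u => \sum_(k < N + N)
    f (vsproj U (complexify (delta_mx 0 k))) * rcoord k (vsval u)).
  apply: measurable_sum => k; apply: measurable_funM => //.
  exact: measurable_rcoord_subvs.
by apply/funext => u; exact: real_linear_subvsE.
Qed.

(** The sigma-algebra of a subspace is generated by the real coordinates, hence
    measurability of a map into it can be tested on them. *)
Lemma measurable_fun_subvsP d (T : measurableType d) (g : T -> subvs_of U) :
  measurable_fun [set: T] g <->
  forall k, measurable_fun [set: T] (fun t => rcoord k (vsval (g t))).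
Proof.
split=> [mg k|mg].
  exact: (measurableT_comp (measurable_rcoord_subvs k) mg).
apply: (@measurability _ _ _ _ setT g (\big[setU/set0]_(k < N + N)
  preimage_set_system setT (fun u : subvs_of U => rcoord k (vsval u)) measurable)).
  by [].
move=> _ [A + <-]; rewrite -bigcup_seq => -[k _ [B mB <-]].
by rewrite [X in _ `&` (_ @^-1` X)]setTI; exact: mg.
Qed.

Lemma measurable_sub_subvs d (T : measurableType d) (g h : T -> subvs_of U) :
  measurable_fun [set: T] g -> measurable_fun [set: T] h ->
  measurable_fun [set: T] (fun t => g t - h t).
Proof.
move=> /measurable_fun_subvsP mg /measurable_fun_subvsP mh.
apply/measurable_fun_subvsP => k.
under eq_fun do rewrite (real_linearB (real_linear_rcoord_subvs k)).
exact: measurable_funB.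
Qed.

Lemma sqnormE (u : subvs_of U) :
  sqnorm u = \sum_(k < N + N) rcoord k (vsval u) ^+ 2.
Proof. exact: hnormX2. Qed.

Lemma measurable_sqnorm : measurable_fun [set: subvs_of U] (@sqnorm R N U).
Proof.
rewrite (_ : @sqnorm R N U = fun u => \sum_(k < N + N) rcoord k (vsval u) ^+ 2).
  apply: measurable_sum => k; apply: measurable_funX.
  exact: measurable_rcoord_subvs.
by apply/funext => u; rewrite sqnormE.
Qed.

Lemma sqnorm_ge0 (u : subvs_of U) : 0 <= sqnorm u.
Proof. exact: sqr_ge0. Qed.

Lemma sqnorm_eq0 (u : subvs_of U) : sqnorm u = 0 -> u = 0.
Proof.
by move=> /eqP; rewrite sqrf_eq0 => /eqP/hnorm_eq0 u0; exact: val_inj.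
Qed.

Lemma sqnormB_le (u v : subvs_of U) : sqnorm (u - v) <= 2 * sqnorm u + 2 * sqnorm v.
Proof.
rewrite !sqnormE !mulr_sumr -big_split/=; apply: ler_sum => k _.
rewrite (real_linearB (real_linear_rcoord_subvs k)).
by have := sqr_ge0 (rcoord k (vsval u) + rcoord k (vsval v)); nra.
Qed.

Lemma measurable_hnorm_subvs :
  measurable_fun [set: subvs_of U] (fun u => hnorm (vsval u)).
Proof.
rewrite (_ : (fun u => _) = Num.sqrt \o @sqnorm R N U).
  apply: measurableT_comp measurable_sqnorm.
  by apply: continuous_measurable_fun; exact: sqrt_continuous.
by apply/funext => u /=; rewrite sqrtr_sqr ger0_norm// hnorm_ge0.
Qed.

End subspace.
End coordinates.

(** * Vector integrals and fibre means *)

Section vect_integral_theory.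
Context (R : realType) d (T : measurableType d).

Lemma Rintegral_sum (nu : {measure set T -> \bar R}) (I : Type) (s : seq I)
    (F : I -> T -> R) :
  (forall i, nu.-integrable setT (EFin \o F i)) ->
  \int[nu]_x (\sum_(i <- s) F i x) = \sum_(i <- s) \int[nu]_x F i x.
Proof.
move=> iF; elim: s => [|i s ih].
  under eq_Rintegral do rewrite big_nil.
  by rewrite Rintegral_cst// mul0r big_nil.
rewrite big_cons -ih -RintegralD//.
  by apply: eq_Rintegral => x _; rewrite big_cons.
rewrite (_ : EFin \o _ = fun x => (\sum_(j <- s) (EFin \o F j) x)%E).
  exact: integrable_sum.
by apply/funext => x /=; rewrite sumEFin.
Qed.

Variable V : vectType R[i].
Let b := vbasis {:V}.

Lemma real_linear_Re_coord j : real_linear (fun v => complex.Re (coord b j v)).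
Proof. by move=> r u v; rewrite linearP real_linear_Re. Qed.

Lemma real_linear_Im_coord j : real_linear (fun v => complex.Im (coord b j v)).
Proof. by move=> r u v; rewrite linearP real_linear_Im. Qed.

Variable L : V -> R.
Hypothesis lL : real_linear L.

Lemma real_linear_coordE v : L v = \sum_(j < \dim {:V})
  (complex.Re (coord b j v) * L b`_j + complex.Im (coord b j v) * L ('i%C *: b`_j)).
Proof.
rewrite [in LHS](coord_vbasis (memvf v)) (real_linear_sum lL).
by apply: eq_bigr => j _; rewrite (real_linear_complexZ lL).
Qed.

Lemma real_linear_vect_integralE (nu : {measure set T -> \bar R}) (f : T -> V) :
  L (vect_integral nu f) = \sum_(j < \dim {:V})
    ((\int[nu]_x complex.Re (coord b j (f x))) * L b`_j
     + (\int[nu]_x complex.Im (coord b j (f x))) * L ('i%C *: b`_j)).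
Proof.
rewrite (real_linear_sum lL).
by apply: eq_bigr => j _; rewrite (real_linear_complexZ lL).
Qed.

(** Both sides have the same expansion over the complex basis that defines the
    vector integral; integrability of the coordinates is what lets the finite
    sum and the integral be exchanged. *)
Lemma real_linear_vect_integral (nu : {measure set T -> \bar R}) (f : T -> V) :
  (forall l : V -> R, real_linear l -> nu.-integrable setT (EFin \o (l \o f))) ->
  L (vect_integral nu f) = \int[nu]_x L (f x).
Proof.
move=> intf.
have intRe j : nu.-integrable setT (EFin \o (fun x => complex.Re (coord b j (f x)))).
  exact: intf (real_linear_Re_coord j).
have intIm j : nu.-integrable setT (EFin \o (fun x => complex.Im (coord b j (f x)))).
  exact: intf (real_linear_Im_coord j).
have intZ (g : T -> R) (a : R) : nu.-integrable setT (EFin \o g) ->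
    nu.-integrable setT (EFin \o (fun x => g x * a)).
  move=> ig; rewrite (_ : _ \o _ = fun x => (a%:E * (g x)%:E)%E).
    exact: integrableZl.
  by apply/funext => x; rewrite -EFinM mulrC.
rewrite real_linear_vect_integralE.
under [RHS]eq_Rintegral do rewrite real_linear_coordE.
rewrite Rintegral_sum => [|j].
  apply: eq_bigr => j _.
  rewrite RintegralD//; [|exact: intZ..].
  by rewrite !RintegralZr.
rewrite (_ : _ \o _ =
    ((EFin \o (fun x => (complex.Re (coord b j (f x)) * L b`_j)%R))
    \+ (EFin \o (fun x => (complex.Im (coord b j (f x)) * L ('i%C *: b`_j))%R)))%E)//.
by apply: integrableD => //; exact: intZ.
Qed.

End vect_integral_theory.

(** The positive and the negative part have measurable fibre integrals, and
    extended subtraction and [fine] are measurable; hence the default values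
    taken on fibres where [f] is not integrable do not spoil measurability. *)
Lemma measurable_Rintegral_kernel (R : realType) d1 d2 (X : measurableType d1)
    (Y : measurableType d2) (k : R.-ker X ~> Y) (f : Y -> R) :
  measurable_fun [set: Y] f ->
  measurable_fun [set: X] (fun x => \int[k x]_y f y).
Proof.
move=> mf; apply: measurableT_comp => //.
under eq_fun do rewrite integralE.
have mEf : measurable_fun [set: Y] (EFin \o f) by exact/measurable_EFinP.
apply: emeasurable_funB; apply: measurable_fun_integral_kernel => //.
- by move=> A mA; exact: measurable_kernel.
- exact: measurable_funepos.
- by move=> A mA; exact: measurable_kernel.
- exact: measurable_funeneg.
Qed.

Section kernel_mean.
Context (R : realType) (N : nat) (U : {vspace 'cV[R[i]]_N}).

Lemma integrable_real_linear (nu : {measure set (subvs_of U) -> \bar R})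
    (f : subvs_of U -> R) :
  nu.-integrable setT (fun u => (hnorm (vsval u))%:E) -> real_linear f ->
  nu.-integrable setT (EFin \o f).
Proof.
move=> inorm lf.
pose C := \sum_(k < N + N) `|f (vsproj U (complexify (delta_mx 0 k)))|.
apply: (le_integrable measurableT _ _ (integrableZl measurableT C inorm)).
  by apply/measurable_EFinP; exact: measurable_real_linear_subvs.
move=> u _ /=; rewrite lee_fin (real_linear_subvsE _ lf).
apply: (le_trans (ler_norm_sum _ _ _)).
rewrite [leRHS]ger0_norm; last first.
  by rewrite mulr_ge0 ?hnorm_ge0// sumr_ge0.
rewrite mulr_suml; apply: ler_sum => k _.
by rewrite normrM ler_wpM2l// le_rcoord_hnorm.
Qed.

(** Each real coordinate of the mean is a fixed combination of fibre integrals of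
    real and imaginary parts of complex coordinates. *)
Lemma measurable_kernel_mean d (X : measurableType d)
    (k : R.-ker X ~> (subvs_of U)) :
  measurable_fun [set: X] (fun x => vect_integral (k x) (fun u => u)).
Proof.
apply/measurable_fun_subvsP => i.
under eq_fun do rewrite (real_linear_vect_integralE (real_linear_rcoord_subvs i)).
apply: measurable_sum => j; apply: measurable_funD; apply: measurable_funM => //;
  apply: measurable_Rintegral_kernel; apply: measurable_real_linear_subvs.
  exact: real_linear_Re_coord.
exact: real_linear_Im_coord.
Qed.

Section moments.
Local Open Scope ereal_scope.
Variable nu : {measure set (subvs_of U) -> \bar R}.
Hypothesis nu1 : nu setT = 1.
Hypothesis nu2 : \int[nu]_u (sqnorm u)%:E < +oo.

Let integrable_cst (r : R) : nu.-integrable setT (fun=> r%:E).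
Proof.
apply/integrableP; split => //=.
by rewrite integral_cst// nu1 mule1 ltry.
Qed.

Let integrable_sqnorm : nu.-integrable setT (fun u => (sqnorm u)%:E).
Proof.
apply/integrableP; split; first by apply/measurable_EFinP; exact: measurable_sqnorm.
rewrite (eq_integral (fun u => (sqnorm u)%:E))// => u _.
by rewrite gee0_abs// lee_fin sqnorm_ge0.
Qed.

Lemma integrable_hnorm : nu.-integrable setT (fun u => (hnorm (vsval u))%:E).
Proof.
(* t <= 1 + t^2 *)
apply: (le_integrable measurableT _ _
  (integrableD measurableT (integrable_cst 1) integrable_sqnorm)).
  by apply/measurable_EFinP; exact: measurable_hnorm_subvs.
move=> u _ /=; rewrite lee_fin !ger0_norm ?hnorm_ge0 ?addr_ge0 ?sqnorm_ge0//.
by rewrite /sqnorm; have := sqr_ge0 (hnorm (vsval u) - 1); nra.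
Qed.

(** The cross term of the expanded square is a real-linear functional of [u - b],
    and its integral vanishes because [b] is the mean. *)
Lemma bias_variance (a : subvs_of U) (b := vect_integral nu (fun u => u)) :
  \int[nu]_u (sqnorm (u - a))%:E =
  \int[nu]_u (sqnorm (u - b))%:E + (sqnorm (b - a))%:E.
Proof.
(* 2 <b - a, u>, so that M (u - b) is the cross term *)
pose M (u : subvs_of U) : R :=
  (\sum_(k < N + N) 2 * rcoord k (vsval (b - a)) * rcoord k (vsval u))%R.
have lM : real_linear M by apply: real_linear_lin => k; exact: real_linear_rcoord_subvs.
pose c : R := (sqnorm (b - a) - M b)%R.
have iM : nu.-integrable setT (EFin \o M).
  exact: (integrable_real_linear integrable_hnorm).
have EM : \int[nu]_u (M u)%:E = (M b)%:E.
  rewrite /b (real_linear_vect_integral lM)/Rintegral.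
    by rewrite fineK//; exact: (integrable_fin_num measurableT iM).
  by move=> l ll; exact: (integrable_real_linear integrable_hnorm).
have isq : nu.-integrable setT (fun u => (sqnorm (u - b))%:E).
  apply: (le_integrable measurableT _ _ (integrableD measurableT
    (integrableZl measurableT 2 integrable_sqnorm) (integrable_cst (2 * sqnorm b)))).
    apply/measurable_EFinP; apply: measurableT_comp; first exact: measurable_sqnorm.
    exact: measurable_sub_subvs.
  move=> u _ /=; rewrite lee_fin !ger0_norm ?sqnorm_ge0 ?sqnormB_le//.
  by rewrite addr_ge0// mulr_ge0// sqnorm_ge0.
transitivity (\int[nu]_u ((sqnorm (u - b))%:E + ((M u)%:E + c%:E))).
  apply: eq_integral => u _; rewrite -!EFinD; congr _%:E.
  transitivity (sqnorm (u - b) + M (u - b) + sqnorm (b - a))%R; last first.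
    by rewrite (real_linearB lM) /c; ring.
  rewrite /M !sqnormE -!big_split /=; apply: eq_bigr => k _.
  have lk := @real_linear_rcoord_subvs _ _ U k.
  by rewrite !(real_linearB lk); ring.
rewrite integralD//; last exact: integrableD.
rewrite integralD// EM integral_cst// nu1 mule1 -EFinD.
by congr (_ + _%:E); rewrite /c addrC subrK.
Qed.

End moments.
End kernel_mean.

(** * Minimization over the fibres of a kernel *)

Section fiberwise_defect.
Local Open Scope ereal_scope.
Context (R : realType) (N : nat) (U : {vspace 'cV[R[i]]_N}).
Context d (X : measurableType d) (m : probability X R).
Variable k : R.-pker X ~> (subvs_of U).

Definition kernel_mean (x : X) : subvs_of U := vect_integral (k x) (fun u => u).

Hypothesis finite_moment : \int[m]_x \int[k x]_u (sqnorm u)%:E < +oo.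

Lemma measurable_defect (Psi : X -> subvs_of U) : measurable_fun setT Psi ->
  measurable_fun [set: X * subvs_of U] (fun p => (sqnorm (p.2 - Psi p.1))%:E).
Proof.
move=> mPsi; apply/measurable_EFinP; apply: measurableT_comp.
  exact: measurable_sqnorm.
by apply: measurable_sub_subvs => //; exact: measurableT_comp.
Qed.

Lemma measurable_fiber_defect (Psi : X -> subvs_of U) :
  measurable_fun setT Psi ->
  measurable_fun setT (fun x => \int[k x]_u (sqnorm (u - Psi x))%:E).
Proof.
move=> mPsi.
apply: (measurable_fun_integral_finite_kernel
  (fun p : X * subvs_of U => (sqnorm (p.2 - Psi p.1))%:E) k) => [p|].
  by rewrite lee_fin sqnorm_ge0.
exact: measurable_defect.
Qed.

Lemma measurable_sqnorm_sub (Phi Psi : X -> subvs_of U) :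
  measurable_fun setT Phi -> measurable_fun setT Psi ->
  measurable_fun setT (fun x => (sqnorm (Phi x - Psi x))%:E).
Proof.
move=> mPhi mPsi; apply/measurable_EFinP; apply: measurableT_comp.
  exact: measurable_sqnorm.
exact: measurable_sub_subvs.
Qed.

(** A nonnegative function with finite integral is finite almost everywhere. *)
Lemma ae_finite_moment : {ae m, forall x, \int[k x]_u (sqnorm u)%:E < +oo}.
Proof.
have : m.-integrable setT (fun x => \int[k x]_u (sqnorm u)%:E).
  apply/integrableP; split.
    have := @measurable_fiber_defect (fun=> 0%R) (measurable_cst _).
    by under eq_fun do under eq_integral do rewrite subr0.
  rewrite (eq_integral (fun x => \int[k x]_u (sqnorm u)%:E))// => x _.
  by rewrite gee0_abs// integral_ge0// => u _; rewrite lee_fin sqnorm_ge0.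
move=> /(integrable_ae measurableT); apply: filterS => x /(_ I).
by rewrite fin_numElt => /andP[].
Qed.

Lemma ae_integrable_hnorm :
  {ae m, forall x, (k x).-integrable setT (fun u => (hnorm (vsval u))%:E)}.
Proof.
apply: filterS ae_finite_moment => x.
by apply: integrable_hnorm; rewrite prob_kernel.
Qed.

(** The bias-variance identity, integrated over the base; it is available on
    almost every fibre since almost every fibre has a second moment. *)
Lemma fiberwise_pythagoras (Psi : X -> subvs_of U) : measurable_fun setT Psi ->
  \int[m]_x \int[k x]_u (sqnorm (u - Psi x))%:E =
  \int[m]_x \int[k x]_u (sqnorm (u - kernel_mean x))%:E +
  \int[m]_x (sqnorm (kernel_mean x - Psi x))%:E.
Proof.
move=> mPsi; have mmean := measurable_kernel_mean k.
have fiber_ge0 Phi x : 0 <= \int[k x]_u (sqnorm (u - Phi x))%:E.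
  by apply: integral_ge0 => u _; rewrite lee_fin sqnorm_ge0.
have bias_ge0 x : 0 <= (sqnorm (kernel_mean x - Psi x))%:E.
  by rewrite lee_fin sqnorm_ge0.
rewrite -ge0_integralD//; [|exact: measurable_fiber_defect|exact: measurable_sqnorm_sub].
apply: ge0_ae_eq_integral => //.
- exact: measurable_fiber_defect.
- apply: emeasurable_funD; [exact: measurable_fiber_defect|].
  exact: measurable_sqnorm_sub.
- by move=> x _; rewrite adde_ge0.
apply: filterS ae_finite_moment => x kx2 _.
by apply: bias_variance => //; rewrite prob_kernel.
Qed.

End fiberwise_defect.

(** * The optimal parameterization *)

Section closure.
Local Open Scope ereal_scope.
Context (R : realType) (N : nat) (Ec Es : {vspace 'cV[R[i]]_N}).
Local Notation Cn := 'cV[R[i]]_N.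
Variable mu : probability Cn R.

Lemma measurable_proj_along (U W : {vspace Cn}) :
  measurable_fun [set: Cn] (proj_along U W).
Proof.
apply/measurable_fun_subvsP => k; apply: measurable_real_linear.
apply: (real_linear_comp (daddv_pi U W)
  (f := fun y => rcoord k (vsval (vsproj U y)))).
exact: (real_linear_comp (vsproj U) (@real_linear_rcoord_subvs _ _ U k)).
Qed.

Let measurable_Pi_c : measurable_fun [set: Cn] (Pi_c Ec Es).
Proof. exact: measurable_proj_along. Qed.

Let measurable_Pi_s : measurable_fun [set: Cn] (Pi_s Ec Es).
Proof. exact: measurable_proj_along. Qed.

HB.instance Definition _ :=
  isMeasurableFun.Build _ _ _ _ (Pi_c Ec Es) measurable_Pi_c.

HB.instance Definition _ := Probability.copy (resolved_law Ec Es mu)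
  (distribution mu (Pi_c Ec Es)).

Variable mu_ : R.-pker (subvs_of Ec) ~> (subvs_of Es).
Hypothesis disint : is_disintegration mu mu_.

(** Apply [integral_disintegration] to the law of the pair (Pi_c y, Pi_s y). *)
Lemma integral_joint_law (f : subvs_of Ec * subvs_of Es -> \bar R) :
  (forall z, 0 <= f z) -> measurable_fun setT f ->
  \int[mu]_y f (Pi_c Ec Es y, Pi_s Ec Es y) =
  \int[resolved_law Ec Es mu]_xi \int[mu_ xi]_zeta f (xi, zeta).
Proof.
move=> f0 mf; pose Pi y := (Pi_c Ec Es y, Pi_s Ec Es y).
have mPi : measurable_fun setT Pi.
  exact: (measurable_fun_pair measurable_Pi_c measurable_Pi_s).
transitivity (\int[pushforward mu Pi]_z f z).
  by rewrite ge0_integral_pushforward// preimage_setT.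
exact: integral_disintegration.
Qed.

Lemma mean_square_defectE (Psi : subvs_of Ec -> subvs_of Es) :
  measurable_fun setT Psi ->
  mean_square_defect mu Psi =
  \int[resolved_law Ec Es mu]_xi \int[mu_ xi]_zeta (sqnorm (zeta - Psi xi))%:E.
Proof.
move=> mPsi; rewrite /mean_square_defect.
rewrite -(integral_joint_law (f := fun p => (sqnorm (p.2 - Psi p.1))%:E))//.
  by move=> p; rewrite lee_fin sqnorm_ge0.
exact: measurable_defect.
Qed.

Lemma measurable_pointwise_defect (Psi : subvs_of Ec -> subvs_of Es) :
  measurable_fun setT Psi ->
  measurable_fun setT
    (fun y => (sqnorm (Pi_s Ec Es y - Psi (Pi_c Ec Es y)))%:E : \bar R).
Proof.
move=> mPsi; apply: (measurable_sqnorm_sub measurable_Pi_s).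
exact: (measurableT_comp mPsi measurable_Pi_c).
Qed.

Hypothesis energy : finite_energy Ec Es mu.

Lemma finite_fiber_moment :
  \int[resolved_law Ec Es mu]_xi \int[mu_ xi]_zeta (sqnorm zeta)%:E < +oo.
Proof.
rewrite -(integral_joint_law (f := fun p => (sqnorm p.2)%:E))//.
  by move=> p; rewrite lee_fin sqnorm_ge0.
apply/measurable_EFinP; apply: measurableT_comp; last exact: measurable_snd.
exact: measurable_sqnorm.
Qed.

Lemma pythagoras (Psi : subvs_of Ec -> subvs_of Es) :
  measurable_fun setT Psi ->
  mean_square_defect mu Psi = mean_square_defect mu (conditional_mean mu_) +
    \int[resolved_law Ec Es mu]_xi (sqnorm (conditional_mean mu_ xi - Psi xi))%:E.
Proof.
move=> mPsi; rewrite !mean_square_defectE//; last exact: measurable_kernel_mean.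
exact: (fiberwise_pythagoras finite_fiber_moment mPsi).
Qed.

Let bias_ge0 (Psi : subvs_of Ec -> subvs_of Es) :
  0 <= \int[resolved_law Ec Es mu]_xi (sqnorm (conditional_mean mu_ xi - Psi xi))%:E.
Proof. by apply: integral_ge0 => xi _; rewrite lee_fin sqnorm_ge0. Qed.

Let defect_ge0 (Psi : subvs_of Ec -> subvs_of Es) : 0 <= mean_square_defect mu Psi.
Proof. by apply: integral_ge0 => xi _; rewrite lee_fin sqnorm_ge0. Qed.

(** [pythagoras] at the zero parameterization, whose defect is the energy. *)
Let energy_split : mean_square_defect mu (conditional_mean mu_) +
  \int[resolved_law Ec Es mu]_xi (sqnorm (conditional_mean mu_ xi))%:E < +oo.
Proof.
have := pythagoras (@measurable_cst _ _ _ _ setT (0%R : subvs_of Es)).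
rewrite /mean_square_defect.
under eq_integral do rewrite subr0.
move=> E; move: energy; rewrite /finite_energy E.
by under [X in _ + X < _ -> _]eq_integral do rewrite subr0.
Qed.

Lemma conditional_mean_L2m : L2m mu (conditional_mean mu_).
Proof.
split; first exact: measurable_kernel_mean.
by apply: le_lt_trans energy_split; rewrite leeDr.
Qed.

Lemma conditional_mean_defect_lty :
  mean_square_defect mu (conditional_mean mu_) < +oo.
Proof.
apply: le_lt_trans energy_split; rewrite leeDl//.
by apply: integral_ge0 => xi _; rewrite lee_fin sqnorm_ge0.
Qed.

Lemma conditional_mean_le (Psi : subvs_of Ec -> subvs_of Es) :
  measurable_fun setT Psi ->
  mean_square_defect mu (conditional_mean mu_) <= mean_square_defect mu Psi.
Proof. by move=> mPsi; rewrite (pythagoras mPsi) leeDl. Qed.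

Lemma conditional_mean_minimizer : is_minimizer mu (conditional_mean mu_).
Proof.
split; first exact: conditional_mean_L2m.
by move=> Phi [mPhi _]; exact: conditional_mean_le.
Qed.

(** For a minimizer the distance term of [pythagoras] cannot be positive, as it
    is added to a finite defect; a nonnegative function with zero integral
    vanishes almost everywhere. *)
Lemma minimizer_unique (Psi : subvs_of Ec -> subvs_of Es) : is_minimizer mu Psi ->
  {ae resolved_law Ec Es mu, forall xi, Psi xi = conditional_mean mu_ xi}.
Proof.
move=> [[mPsi _] /(_ _ conditional_mean_L2m)]; rewrite (pythagoras mPsi).
have mean_fin : mean_square_defect mu (conditional_mean mu_) \is a fin_num.
  rewrite (ge0_fin_numE (defect_ge0 _)).
  exact: conditional_mean_defect_lty.
rewrite -[leRHS]adde0 leeD2lE// => bias_le0.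
have : \int[resolved_law Ec Es mu]_xi
    `|(sqnorm (conditional_mean mu_ xi - Psi xi))%:E| = 0.
  apply/eqP; rewrite eq_le integral_ge0// andbT.
  apply: le_trans bias_le0; rewrite le_eqVlt; apply/orP; left; apply/eqP.
  by apply: eq_integral => xi _; rewrite gee0_abs// lee_fin sqnorm_ge0.
move=> /ae_eq_integral_abs - /(_ measurableT).
move=> /(_ (measurable_sqnorm_sub (measurable_kernel_mean mu_) mPsi)).
apply: filterS => xi /(_ I) [] /sqnorm_eq0/eqP.
by rewrite subr_eq0 => /eqP.
Qed.

(** By [pythagoras] the defect of [Psi] is that of the conditional mean plus the
    squared distance of two square-integrable functions, both finite. *)
Lemma L2m_defect_integrable (Psi : subvs_of Ec -> subvs_of Es) : L2m mu Psi ->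
  mu.-integrable setT
    (EFin \o (fun y => sqnorm (Pi_s Ec Es y - Psi (Pi_c Ec Es y))%R)).
Proof.
move=> [mPsi Psi2]; have [mmean mean2] := conditional_mean_L2m.
apply/integrableP; split; first exact: measurable_pointwise_defect.
apply: (@le_lt_trans _ _ (mean_square_defect mu Psi)).
  rewrite le_eqVlt; apply/orP; left; apply/eqP.
  by apply: eq_integral => y _; rewrite gee0_abs// lee_fin sqnorm_ge0.
rewrite (pythagoras mPsi); apply: lte_add_pinfty.
  exact: conditional_mean_defect_lty.
have msq (Phi : subvs_of Ec -> subvs_of Es) : measurable_fun setT Phi ->
    measurable_fun setT (fun xi => (sqnorm (Phi xi))%:E).
  move=> mPhi; apply/measurable_EFinP; apply: measurableT_comp mPhi.
  exact: measurable_sqnorm.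
apply: (@le_lt_trans _ _ (\int[resolved_law Ec Es mu]_xi
    (2%:E * (sqnorm (conditional_mean mu_ xi))%:E + 2%:E * (sqnorm (Psi xi))%:E))).
  apply: ge0_le_integral => //.
  - by move=> xi _; rewrite lee_fin sqnorm_ge0.
  - exact: measurable_sqnorm_sub.
  - by apply: emeasurable_funD; apply: measurable_funeM; exact: msq.
  - by move=> xi _; rewrite -!EFinM -EFinD lee_fin sqnormB_le.
rewrite ge0_integralD//.
- by rewrite !ge0_integralZl ?lte_add_pinfty ?lte_mul_pinfty//;
    try exact: msq; move=> xi _; rewrite lee_fin sqnorm_ge0.
- by move=> xi _; rewrite mule_ge0 ?lee_fin ?sqnorm_ge0.
- by apply: measurable_funeM; exact: msq.
- by move=> xi _; rewrite mule_ge0 ?lee_fin ?sqnorm_ge0.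
- by apply: measurable_funeM; exact: msq.
Qed.

(** The observable that is averaged depends on [Psi] and is merely integrable, in
    general not continuous. *)
Lemma param_defect_limits (S : R -> Cn -> Cn) (B : set Cn)
    (Psi : subvs_of Ec -> subvs_of Es) :
  physically_relevant S mu B -> L2m mu Psi ->
  \forall y0 \ae @lebesgue_cV R N, B y0 ->
    param_defect (S ^~ y0) Psi tau @[tau --> +oo%R] --> mean_square_defect mu Psi.
Proof. by move=> [_ _ averages] /L2m_defect_integrable /averages. Qed.

End closure.

Theorem theorem4 (R : realType) (N m : nat)
    (A : 'M[R[i]]_N) (G : 'cV[R[i]]_N -> 'cV[R[i]]_N) (F : 'cV[R[i]]_N)
    (beta : N.-tuple R[i]) (e : N.-tuple 'cV[R[i]]_N)
    (T : R -> 'cV[R[i]]_N -> 'cV[R[i]]_N)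
    (mu : probability 'cV[R[i]]_N R) (B : set 'cV[R[i]]_N)
    (Ec := resolved_space e m) (Es := unresolved_space e m)
    (mu_ : R.-pker (subvs_of Ec) ~> (subvs_of Es))
    (Psi_star := conditional_mean mu_) :
  (1 <= m < N)%N ->
  generalized_eigenbasis A beta e ->
  spectrally_ordered beta ->
  spectral_gap beta m ->
  real_C1 G ->
  is_flow (fun y => A *m y + G y + F) T ->
  physically_relevant T mu B ->
  is_disintegration mu mu_ ->
  finite_energy Ec Es mu ->
  [/\ is_minimizer mu Psi_star,
      forall Psi : subvs_of Ec -> subvs_of Es, is_minimizer mu Psi ->
        \forall xi \ae resolved_law Ec Es mu, Psi xi = Psi_star xi,
      \forall xi \ae resolved_law Ec Es mu,
        (mu_ xi).-integrable setT (fun zeta => (hnorm (vsval zeta))%:E) &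
      forall Psi : subvs_of Ec -> subvs_of Es, L2m mu Psi ->
        \forall y0 \ae @lebesgue_cV R N, B y0 ->
          exists l_star l : R,
            [/\ param_defect (T ^~ y0) Psi_star tau @[tau --> +oo%R] --> l_star%:E,
                param_defect (T ^~ y0) Psi tau @[tau --> +oo%R] --> l%:E &
                l_star <= l]].
Proof.
move=> _ _ _ _ _ _ physical disint energy.
have fin_defect (Psi : subvs_of Ec -> subvs_of Es) : L2m mu Psi ->
    exists l : R, mean_square_defect mu Psi = l%:E.
  move=> L2Psi; have iPsi := L2m_defect_integrable disint energy L2Psi.
  exists (fine (mean_square_defect mu Psi)).
  by rewrite (fineK (integrable_fin_num measurableT iPsi)).
split.
- exact: conditional_mean_minimizer.
- by move=> Psi; exact: minimizer_unique.
- exact: ae_integrable_hnorm (finite_fiber_moment disint energy).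
move=> Psi L2Psi.
have L2star := conditional_mean_L2m disint energy.
have [l_star l_starE] := fin_defect _ L2star.
have [l lE] := fin_defect _ L2Psi.
have := param_defect_limits disint energy physical L2Psi.
have := param_defect_limits disint energy physical L2star.
rewrite l_starE lE; apply: filterS2 => y0 star_lim Psi_lim By0.
exists l_star, l; split; [exact: star_lim|exact: Psi_lim|].
rewrite -lee_fin -l_starE -lE.
by case: L2Psi => mPsi _; exact: (conditional_mean_le disint energy mPsi).
Qed.
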